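(* Let $X$ be a finite set and $\mathcal{D}\subseteq\mathcal{R}(X)$. Then $\mathcal{D}$ is a median domain if and only if $\mathcal{D}$ is a closed Condorcet domain.
   Context: $\mathcal{R}(X)$ is the set of strict linear orders on $X$. A profile over $\mathcal{D}$ is $(R_1,\dots,R_n)\in\mathcal{D}^n$ ($n\ge1$), odd if $n$ is odd; its majority relation $P$ is given by $xPy$ iff more than half of the voters rank $x$ above $y$. $\mathcal{D}$ is a Condorcet domain if the majority relation of every profile over $\mathcal{D}$ is acyclic (no $x_1Px_2P\cdots Px_mPx_1$), and a closed Condorcet domain if additionally the majority relation of every odd profile over $\mathcal{D}$ belongs to $\mathcal{D}$. For $R,R'\in\mathcal{R}(X)$ let $[R,R']=\{Q\in\mathcal{R}(X): Q\supseteq R\cap R'\}$. $\mathcal{D}$ is a median domain if for all $R_1,R_2,R_3\in\mathcal{D}$ there is $R\in\mathcal{D}\cap[R_1,R_2]\cap[R_1,R_3]\cap[R_2,R_3]$. *)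

(* Defs.v *)
From HB Require Import structures.
From mathcomp Require Import all_boot.
Set Implicit Arguments.
Unset Strict Implicit.
Unset Printing Implicit Defensive.

(* A binary relation on a finite set X is the set of its pairs, so that
   Leibniz equality, inclusion and intersection are those of relations. *)
Definition brel (X : finType) := {set X * X}.

Definition rel_of (X : finType) (R : brel X) : rel X :=
  fun x y => (x, y) \in R.

Definition is_strict_linear_order (X : finType) (R : brel X) : bool :=
  [&& [forall x, ~~ rel_of R x x],
      [forall y, forall x, forall z,
         rel_of R x y ==> rel_of R y z ==> rel_of R x z]
    & [forall x, forall y, (x != y) ==> rel_of R x y || rel_of R y x]].

Lemma is_strict_linear_orderP (X : finType) (R : brel X) :
  reflect [/\ irreflexive (rel_of R), transitive (rel_of R)
            & forall x y, x != y -> rel_of R x y || rel_of R y x]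
          (is_strict_linear_order R).
Proof.
apply: (iffP and3P) => [[irr tr tot]|[irr tr tot]]; split.
- by move=> x; apply/negbTE; move/forallP: irr; apply.
- move=> y x z xy yz.
  by move/forallP/(_ y)/forallP/(_ x)/forallP/(_ z): tr; rewrite xy yz.
- by move=> x y xy; move/forallP/(_ x)/forallP/(_ y): tot; rewrite xy.
- by apply/forallP => x; rewrite irr.
- apply/forallP => y; apply/forallP => x; apply/forallP => z.
  by apply/implyP => xy; apply/implyP => yz; apply: tr xy yz.
- apply/forallP => x; apply/forallP => y; apply/implyP; exact: tot.
Qed.

Definition strict_linear_orders (X : finType) : {set brel X} :=
  [set R | is_strict_linear_order R].

Definition profile_over (X : finType) (D : {set brel X}) (n : nat)
    (p : n.-tuple (brel X)) : Prop :=
  0 < n /\ (forall i : 'I_n, tnth p i \in D).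

Definition majority (X : finType) (n : nat) (p : n.-tuple (brel X)) : brel X :=
  [set xy : X * X | n < 2 * #|[set i : 'I_n | xy \in tnth p i]|].

(* cycle e [:: x_1; ...; x_m] reads x_1 e x_2, ..., x_(m-1) e x_m, x_m e x_1;
   it holds of the empty sequence, which is therefore excluded. *)
Definition acyclic (X : finType) (P : brel X) : Prop :=
  ~ exists2 s : seq X, s != [::] & cycle (rel_of P) s.

Definition Condorcet_domain (X : finType) (D : {set brel X}) : Prop :=
  forall (n : nat) (p : n.-tuple (brel X)),
    profile_over D p -> acyclic (majority p).

Definition closed_Condorcet_domain (X : finType) (D : {set brel X}) : Prop :=
  Condorcet_domain D /\
  forall (n : nat) (p : n.-tuple (brel X)),
    profile_over D p -> odd n -> majority p \in D.

Definition order_interval (X : finType) (R R' : brel X) : {set brel X} :=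
  [set Q in strict_linear_orders X | R :&: R' \subset Q].

Definition median_domain (X : finType) (D : {set brel X}) : Prop :=
  forall R1 R2 R3 : brel X, R1 \in D -> R2 \in D -> R3 \in D ->
    exists R : brel X,
      R \in D :&: order_interval R1 R2 :&: order_interval R1 R3
              :&: order_interval R2 R3.

(* Main.v *)
(** Among two pairs, each ranked by more than half of the voters, some voter
    ranks both.  In a median domain this pairwise compatibility propagates as in
    Helly's theorem: given orders containing all prescribed pairs but the first,
    the second and the third respectively, their median contains all of them.
    Hence some member of the domain contains the whole majority relation, which
    is therefore acyclic; for an odd profile the majority relation is complete,
    so it equals that member.  Conversely, the majority relation of a profile of
    three orders is a median of them. *)

Require Import Defs.
From mathcomp Require Import all_boot.
From mathcomp Require Import zify.
Set Implicit Arguments.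
Unset Strict Implicit.
Unset Printing Implicit Defensive.

Lemma linear_order_swap (X : finType) (R : brel X) (x y : X) :
  R \in strict_linear_orders X -> x != y -> ((y, x) \in R) = ((x, y) \notin R).
Proof.
rewrite inE => /is_strict_linear_orderP[irr tr tot] neq_xy.
have := tot _ _ neq_xy; rewrite /rel_of.
case xyR: ((x, y) \in R) => //= _; apply/negP => yxR.
by have := tr _ _ _ xyR yxR; rewrite irr.
Qed.

(** Along a cycle of [M], transitivity of [R] would rank the first vertex above itself. *)
Lemma acyclic_sub_linear_order (X : finType) (M R : brel X) :
  R \in strict_linear_orders X -> M \subset R -> acyclic M.
Proof.
rewrite inE => /is_strict_linear_orderP[irr tr _] /subsetP sMR [[//|x s] _ /=].
move=> /(sub_path (e' := rel_of R) (fun x y => sMR (x, y))).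
by move=> /(order_path_min tr)/allP/(_ x); rewrite mem_rcons mem_head irr => /(_ isT).
Qed.

Lemma median_domain_helly (X : finType) (D : {set brel X}) (M : brel X) :
  median_domain D -> D != set0 ->
  (forall a b, a \in M -> b \in M -> exists2 R, R \in D & (a \in R) && (b \in R)) ->
  exists2 R, R \in D & M \subset R.
Proof.
move=> medD /set0Pn[R0 R0D] pairwise.
(* The induction is on a length bound, since lists with their second or third entry deleted are not
   tails. [R0] serves the empty list. *)
suff cover n (s : seq (X * X)) : size s <= n -> all (mem M) s ->
    exists2 R, R \in D & all (mem R) s.
  have [|R RD /allP sR] := cover _ (enum M) (leqnn _).
    by apply/allP => a; rewrite mem_enum.
  by exists R => //; apply/subsetP => a aM; apply: sR; rewrite mem_enum.
elim: n s => [|n IHn] [|a [|b [|c s]]] //=; try by exists R0.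
- by move=> _ /andP[aM _]; have [R RD /andP[aR _]] := pairwise a a aM aM;
     exists R; rewrite ?aR.
- by move=> _ /and3P[aM bM _]; have [R RD /andP[aR bR]] := pairwise a b aM bM;
     exists R; rewrite ?aR ?bR.
rewrite ltnS => le_sn /and4P[aM bM cM sM].
have [||R1 R1D /and3P[bR1 cR1 /allP sR1]] := IHn [:: b, c & s] => //=.
  by rewrite bM cM.
have [||R2 R2D /and3P[aR2 cR2 /allP sR2]] := IHn [:: a, c & s] => //=.
  by rewrite aM cM.
have [||R3 R3D /and3P[aR3 bR3 _]] := IHn [:: a, b & s] => //=.
  by rewrite aM bM.
have [R] := medD _ _ _ R1D R2D R3D; rewrite !inE.
case/andP=> /andP[/andP[RD /andP[_ /subsetP R12]] /andP[_ /subsetP R13]].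
case/andP=> _ /subsetP R23; exists R => //.
(* Each of [a], [b], [c] lies in the two orders not built by omitting it, and [s] lies in [R1] and
   [R2]. *)
apply/and4P; split; [apply: R23|apply: R13|apply: R12|apply/allP => d ds; apply: R12].
all: by rewrite inE; apply/andP; split => //; (exact: sR1 || exact: sR2).
Qed.

Lemma majority_common_voter (X : finType) (n : nat) (p : n.-tuple (brel X)) a b :
  a \in majority p -> b \in majority p ->
  exists i, (a \in tnth p i) && (b \in tnth p i).
Proof.
rewrite !inE; set A := [set i | a \in _]; set B := [set i | b \in _] => ltA ltB.
(* Inclusion-exclusion: both sets exceed half of [n], but their union has at most [n] voters. *)
have: 0 < #|A :&: B|.
  have leUn : #|A :|: B| <= n by rewrite -[n in _ <= n]card_ord max_card.
  by have := cardsUI A B; lia.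
by case/card_gt0P=> i; rewrite !inE; exists i.
Qed.

Lemma median_domain_majority_sub (X : finType) (D : {set brel X}) n
    (p : n.-tuple (brel X)) :
  median_domain D -> profile_over D p -> exists2 R, R \in D & majority p \subset R.
Proof.
move=> medD [n_gt0 pD]; apply: median_domain_helly => //.
  by apply/set0Pn; exists (tnth p (Ordinal n_gt0)).
by move=> a b aM bM; have [i] := majority_common_voter aM bM; exists (tnth p i).
Qed.

(** The voters for [(x, y)] and those for [(y, x)] are complementary, and an odd [n] excludes a
    tie. *)
Lemma majority_odd_total (X : finType) n (p : n.-tuple (brel X)) (x y : X) :
  (forall i, tnth p i \in strict_linear_orders X) -> odd n -> x != y ->
  (x, y) \notin majority p -> (y, x) \in majority p.
Proof.
move=> linp oddn neq_xy; rewrite !inE.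
set A := [set i | (x, y) \in tnth p i].
have -> : [set i | (y, x) \in tnth p i] = ~: A.
  by apply/setP => i; rewrite !inE; apply: linear_order_swap.
have := cardsC A; rewrite card_ord => cardA; lia.
Qed.

(** Two of three voters outvote the third. *)
Lemma majority3_supset (X : finType) (p : 3.-tuple (brel X)) (i j : 'I_3) :
  i != j -> tnth p i :&: tnth p j \subset majority p.
Proof.
move=> neq_ij; apply/subsetP => a; rewrite !inE => /andP[ai aj].
set A := [set k | _]; have: [set i; j] \subset A.
  by apply/subsetP => k; rewrite !inE => /orP[] /eqP ->.
move/subset_leq_card; rewrite cards2 neq_ij => leA; lia.
Qed.

Theorem theorem2 (X : finType) (D : {set brel X})
    (hD : D \subset strict_linear_orders X) :
  median_domain D <-> closed_Condorcet_domain D.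
Proof.
move/subsetP: hD => hD; split=> [medD|[_ majD] R1 R2 R3 R1D R2D R3D].
  split=> n p pD; have [R RD sMR] := median_domain_majority_sub medD pD.
    exact: acyclic_sub_linear_order (hD _ RD) sMR.
  move=> oddn; suff -> : majority p = R by [].
  apply/eqP; rewrite eqEsubset sMR; apply/subsetP => -[x y] xyR.
  have neq_xy : x != y.
    have := hD _ RD; rewrite inE => /is_strict_linear_orderP[irr _ _].
    by apply: contraTneq xyR => ->; apply/negbT/irr.
  (* If [(x, y)] were not in the majority, [(y, x)] would be, hence also in [R], against
     asymmetry. *)
  apply: contraLR xyR => /(majority_odd_total _ oddn neq_xy) yxM.
  rewrite -(linear_order_swap (hD _ RD) neq_xy); apply: (subsetP sMR).
  by apply: yxM => i; apply: hD; case: pD.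
pose p := [tuple R1; R2; R3].
have MD : majority p \in D.
  by apply: majD => //; split=> // i; have /= := mem_tnth i p;
    rewrite !inE => /or3P[] /eqP ->.
have interval i j : i != j -> majority p \in order_interval (tnth p i) (tnth p j).
  by move=> neq_ij; rewrite inE (hD _ MD) majority3_supset.
exists (majority p); rewrite 3!in_setI MD -!andbA /=.
pose i1 := @Ordinal 3 1 isT; apply/and3P; split.
- exact: (interval ord0 i1).
- exact: (interval ord0 ord_max).
- exact: (interval i1 ord_max).
Qed.
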